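(* Assume the following two conditions. (i) There exist positive absolute constants $\xi_1,\xi_2,\xi_3$ such that, for every sufficiently large $n$ and every $\theta\in\Theta_n$, $$P_\star^{(n)}\left[\exp(-\lambda\{\ell_n(\theta)-\ell_n^\star\})\right]\le \exp(-\xi_1\mathcal L_n(\theta)),\qquad P_\star^{(n)}\left[\exp(\lambda\xi_2\{\ell_n(\theta)-\ell_n^\star\})\right]\le \exp(\xi_3\mathcal L_n(\theta)).$$ (ii) There exists an absolute constant $\xi_4>0$ such that, for every sufficiently large $n$ and every $k\in[M_n]$, there is a distribution $Q^*_{n,k}\in\mathcal Q_{n,k}$ with $$\log\left(\int\exp(\xi_3\mathcal L_n(\theta))\,dQ^*_{n,k}(\theta)\right)\le \xi_4\mathcal E_n(k),\qquad \mathrm{KL}(Q^*_{n,k},\Pi_{n,k})\le\xi_4\mathcal E_n(k).$$ Then there exist absolute constants $\tau_*>0$ and $C_2>0$ such that, for every sufficiently large $n$, $$P_\star^{(n)}\left(\widehat m_n\ge k_n^\dagger(\tau_* )+1\right)\ge 1-\eta_n,\qquad \eta_n:=k_n^\dagger(\tau_* )\exp\left(-C_2\,\mathcal E_n(k_n^\dagger(\tau_* ))\right).$$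
   Context: Setup. For each $n$, a sample $X^{(n)}$ with values in a measurable space $\mathcal X_n$ is drawn from the true distribution $P_\star^{(n)}$; $P_\star^{(n)}[\cdot]$ denotes expectation and $P_\star^{(n)}(\cdot)$ probability under it. $\mathcal P(\cdot)$ is the set of probability measures on a space; $[m]=\{1,\dots,m\}$; $a\wedge b=\min\{a,b\}$. The models are parameter spaces $\Theta_{n,1},\dots,\Theta_{n,M_n}$, each $\theta$ indexing a distribution $P_\theta^{(n)}\in\mathcal P(\mathcal X_n)$, and they are nested: for each $k<M_n$ there is an embedding $T:\Theta_{n,k}\to\Theta_{n,k+1}$ with $P^{(n)}_\theta=P^{(n)}_{T(\theta)}$ for all $\theta\in\Theta_{n,k}$. Put $\Theta_n=\bigcup_{k=1}^{M_n}\Theta_{n,k}$. A loss $\ell_n:\mathcal P(\mathcal X_n)\times\mathcal X_n\to[0,\infty)$ is given; write $\ell_n(\theta)=\ell_n(P_\theta^{(n)},X^{(n)})$ and $\ell_n^\star=\ell_n(P_\star^{(n)},X^{(n)})$. The excess risk is $\mathcal L_n(\theta)=P_\star^{(n)}[\ell_n(\theta)-\ell_n^\star]$. $\mathrm{KL}(P_1,P_2)=\int\log(dP_1/dP_2)\,dP_1$ if $P_1\ll P_2$, and $\infty$ otherwise. ''Absolute constant'' means a constant not depending on $n$ or $k$. Variational Bayes. $\lambda>0$ is a fixed constant (learning rate). For each $k\in[M_n]$, $\Pi_{n,k}$ is a prior distribution on $\Theta_{n,k}$ and $\mathcal Q_{n,k}\subset\mathcal P(\Theta_{n,k})$ is a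 variational family. The variational posterior $\widehat Q_{n,k}$ is a minimizer over $Q\in\mathcal Q_{n,k}$ of $\lambda\int\ell_n(\theta)\,dQ(\theta)+\mathrm{KL}(Q,\Pi_{n,k})$, and $\mathrm{mVFE}_n(k)$ is the minimum value, i.e. $\mathrm{mVFE}_n(k)=\lambda\int\ell_n(\theta)\,d\widehat Q_{n,k}(\theta)+\mathrm{KL}(\widehat Q_{n,k},\Pi_{n,k})$. Stopping index: $\widehat m_n=\inf\{k\in[M_n]\setminus\{1\}:\mathrm{mVFE}_n(k-1)<\mathrm{mVFE}_n(k)\}\wedge M_n$ (with $\inf\emptyset=\infty$). Excess risk of model $k$: $\mathcal E_n(k)=-\log\left(\int\exp(-\xi_1\mathcal L_n(\theta))\,d\Pi_{n,k}(\theta)\right)$, with the same constant $\xi_1$ as in condition (i). Near-optimal index: for $\tau>0$, $k_n^\dagger(\tau)=\inf\{k\in[M_n]:\mathcal E_n(k)\le(1+\tau)\mathcal E_n(k+1)\}\wedge M_n$ (so it equals $M_n$ if no $k<M_n$ satisfies the inequality).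
   Formalization: The event is proved as m̂_n ≥ min{k_n†(τ_* )+1, M_n}; as m̂_n ≤ M_n always, the stated event is impossible when k_n† = M_n (e.g. M_n = 1 with positive excess risk), and the two events coincide when k_n† < M_n. *)

(* Defs.v *)
From HB Require Import structures.
From mathcomp Require Import all_boot all_order all_algebra.
From mathcomp Require Import all_classical all_reals all_analysis.
Set Implicit Arguments.
Unset Strict Implicit.
Unset Printing Implicit Defensive.
Import Order.TTheory GRing.Theory Num.Theory.
Import numFieldNormedType.Exports.
Local Open Scope classical_set_scope.
Local Open Scope ring_scope.
Local Open Scope charge_scope.

Definition KL d (T : measurableType d) (R : realType)
    (P1 P2 : probability T R) : \bar R :=
  if pselect (P1 `<< P2)
  then (\int[P1]_x lne (('d (charge_of_finite_measure P1) '/d P2) x))%E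
  else +oo%E.

(* The data at one sample size n.  Models are indexed by all of nat, but only
   the indices 1 <= k <= nmodels are meaningful; the components at other
   indices are unconstrained placeholders.
   [loss_measurable_true] and [loss_measurable] are what makes the expectations
   over the sample and the integrals over the parameter well defined.
   A [probability] is a function on all sets, so two of them are the same
   measure when they agree on measurable sets: hence the form of [nested]. *)
Record experiment (R : realType) := Experiment {
  sample_display : measure_display ;
  sample : measurableType sample_display ;
  Pstar : probability sample R ;
  nmodels : nat ;
  param_display : nat -> measure_display ;
  param : forall k, measurableType (param_display k) ;
  Ptheta : forall k, param k -> probability sample R ;
  loss : probability sample R -> sample -> R ;
  prior : forall k, probability (param k) R ;
  vfamily : forall k, set (probability (param k) R) ;
  nmodels_gt0 : (0 < nmodels)%N ;
  nested : forall k, (1 <= k < nmodels)%N ->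
    exists T : param k -> param k.+1, injective T /\
      forall theta A, measurable A ->
        Ptheta theta A = Ptheta (T theta) A ;
  loss_ge0 : forall P x, 0 <= loss P x ;
  loss_measurable_true : measurable_fun [set: sample] (loss Pstar) ;
  loss_measurable : forall k, (1 <= k <= nmodels)%N ->
    measurable_fun [set: param k * sample]
      (fun z => loss (Ptheta z.1) z.2) }.

Arguments Pstar {R} _.
Arguments nmodels {R} _.
Arguments loss {R} _ _ _.
Arguments Ptheta {R} _ {k} _.
Arguments prior {R} _ _.
Arguments vfamily {R} _ _ _.

Section Risk.
Context {R : realType} (S : experiment R).
Local Open Scope ereal_scope.

Definition loss_diff k (theta : param S k) (x : sample S) : R :=
  (loss S (Ptheta S theta) x - loss S (Pstar S) x)%R.

Definition excess_risk k (theta : param S k) : \bar R :=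
  'E_(Pstar S)[loss_diff theta].

Definition model_excess_risk (xi1 : R) (k : nat) : \bar R :=
  - lne (\int[prior S k]_theta expeR (- (xi1%:E * excess_risk theta))).

Definition variational_objective (lambda : R) k (x : sample S)
    (Q : probability (param S k) R) : \bar R :=
  lambda%:E * (\int[Q]_theta (loss S (Ptheta S theta) x)%:E)
  + KL Q (prior S k).

Definition is_variational_posterior (lambda : R) k (x : sample S)
    (Q : probability (param S k) R) : Prop :=
  vfamily S k Q /\
  forall Q', vfamily S k Q' ->
    variational_objective lambda x Q <= variational_objective lambda x Q'.

Definition mVFE (lambda : R)
    (Qhat : forall k, sample S -> probability (param S k) R)
    (x : sample S) (k : nat) : \bar R :=
  variational_objective lambda x (Qhat k x).

(* A \big[minn/M] is the minimum of M and of the indices selected, so it is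
   "inf {...} /\ M" with inf of the empty set = oo. *)
Definition stopping_index (lambda : R)
    (Qhat : forall k, sample S -> probability (param S k) R)
    (x : sample S) : nat :=
  \big[minn/nmodels S]_(2 <= k < (nmodels S).+1 |
      mVFE lambda Qhat x k.-1 < mVFE lambda Qhat x k) k.

(* The index k = nmodels, whose condition would involve a nonexistent model,
   is left out: it could only contribute the value of the cap.  When this index
   equals nmodels, near_optimal_index + 1 is beyond every value of
   stopping_index, so lower bounds on the latter by the former are to be capped
   at nmodels. *)
Definition near_optimal_index (xi1 tau : R) : nat :=
  \big[minn/nmodels S]_(1 <= k < nmodels S |
      model_excess_risk xi1 k <= (1 + tau)%:E * model_excess_risk xi1 k.+1) k.

Definition eta (xi1 tau C2 : R) : \bar R :=
  let kd := near_optimal_index xi1 tau in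
  kd%:R%:E * expeR (- (C2%:E * model_excess_risk xi1 kd)).

Definition loss_exponential_moments (lambda xi1 xi2 xi3 : R) : Prop :=
  forall k (theta : param S k), (1 <= k <= nmodels S)%N ->
    'E_(Pstar S)[fun x => expR (- lambda * loss_diff theta x)]
      <= expeR (- (xi1%:E * excess_risk theta)) /\
    'E_(Pstar S)[fun x => expR (lambda * xi2 * loss_diff theta x)]
      <= expeR (xi3%:E * excess_risk theta).

Definition good_variational_family (xi1 xi3 xi4 : R) : Prop :=
  forall k, (1 <= k <= nmodels S)%N ->
    exists Qstar : probability (param S k) R,
      [/\ vfamily S k Qstar,
          lne (\int[Qstar]_theta expeR (xi3%:E * excess_risk theta))
            <= xi4%:E * model_excess_risk xi1 k &
          KL Qstar (prior S k) <= xi4%:E * model_excess_risk xi1 k].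

End Risk.

(* Main.v *)
(** By the Donsker-Varadhan inequality the minimal variational free energy of
    model k is at least [lambda * loss Pstar - log Z], where [Z] is a
    prior integral whose expectation is at most [exp (- E k)] by (i) and Tonelli;
    by Jensen's inequality at the distribution of (ii), it is at most
    [lambda * loss Pstar + c * E k] up to a similar exponential moment. By
    Markov's inequality both bounds hold for model k outside an event of
    probability O(exp (- E k / 2)), with [E k / 2] in the lower bound. Hence, if
    [tau] is large, the strict drop [E k > (1 + tau) * E (k + 1)] which holds
    below the near-optimal index forces the free energy to decrease from k to
    k + 1. The union bound over these k concludes, since [E] is smallest at the
    near-optimal index. *)
Require Import Defs.
From mathcomp Require Import all_boot all_order all_algebra.
From mathcomp Require Import all_classical all_reals all_analysis measurable_realfun.
From mathcomp Require Import ring lra.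
Set Implicit Arguments.
Unset Strict Implicit.
Unset Printing Implicit Defensive.
Import Order.TTheory GRing.Theory Num.Theory.
Import numFieldNormedType.Exports.
Local Open Scope classical_set_scope.
Local Open Scope ring_scope.

(** * Relative entropy and the Donsker-Varadhan inequality *)

Section Gibbs.
Context d (T : measurableType d) (R : realType).
Local Open Scope ereal_scope.
Implicit Types (P Q : probability T R) (g w : T -> R).

(* [expR (- ln r)] stands for [1 / r]: it is [1] where [r = 0], since
   [ln 0 = 0]. *)
Lemma integral_tilted_le P Q w : Q `<< P ->
  measurable_fun [set: T] w -> (forall x, 0 <= w x)%R ->
  \int[Q]_x (w x * expR (- ln (fine (Radon_Nikodym_SigmaFinite.f Q P x))))%:E
    <= \int[P]_x (w x)%:E.
Proof.
move=> QP mw w0; set r := Radon_Nikodym_SigmaFinite.f Q P.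
have mr : measurable_fun [set: T] r
  by exact/measurable_int/Radon_Nikodym_SigmaFinite.f_integrable.
have mfr : measurable_fun [set: T] (fun x => fine (r x)).
  by apply: measurableT_comp.
have mu : measurable_fun [set: T] (fun x => (w x * expR (- ln (fine (r x))))%:E).
  apply/measurable_EFinP/measurable_funM => //.
  apply: measurableT_comp => //; apply: measurableT_comp => //.
  by apply: measurableT_comp.
rewrite -(Radon_Nikodym_SigmaFinite.change_of_variables QP) //; last first.
  by move=> x; rewrite lee_fin mulr_ge0// expR_ge0.
apply: ge0_le_integral => //.
- move=> x _; rewrite mule_ge0//; last exact: Radon_Nikodym_SigmaFinite.f_ge0.
  by rewrite lee_fin mulr_ge0// expR_ge0.
- exact: emeasurable_funM.
- exact/measurable_EFinP.
move=> x _; rewrite -/r -(@fineK _ (r x)); last exact: Radon_Nikodym_SigmaFinite.f_fin_num.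
have : (0 <= fine (r x))%R by rewrite fine_ge0// Radon_Nikodym_SigmaFinite.f_ge0.
(* Where [r = 0] the product vanishes and [w >= 0] is enough; where [r > 0] the factor
   [expR (- ln r)] cancels [r]. The result is only an inequality because the [P]-mass of [r = 0] is
   lost. *)
rewrite -EFinM lee_fin le_eqVlt => /predU1P[<-|r0]; first by rewrite mulr0.
by rewrite expRN lnK ?posrE// mulfVK// gt_eqF.
Qed.

(** The [Q]-mass of the set where the density is at most 0 is the [P]-integral of the density over
    that set, hence 0. *)
Lemma density_gt0_ae P Q : Q `<< P ->
  {ae Q, forall x, (0 < fine (Radon_Nikodym_SigmaFinite.f Q P x))%R}.
Proof.
move=> QP; set r := Radon_Nikodym_SigmaFinite.f Q P.
have mr : measurable_fun [set: T] r
  by exact/measurable_int/Radon_Nikodym_SigmaFinite.f_integrable.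
have mA : measurable [set x | r x <= 0].
  by rewrite -[X in measurable X]setTI; apply: emeasurable_fun_infty_c.
exists [set x | r x <= 0]; split => //.
  rewrite (Radon_Nikodym_SigmaFinite.f_integral QP)//.
  apply: integral0_eq => x /= rx0; apply/eqP; rewrite eq_le rx0.
  exact: Radon_Nikodym_SigmaFinite.f_ge0.
move=> x /= /negP; rewrite -leNgt => rx0.
by rewrite -(@fineK _ (r x)) ?lee_fin//; exact: Radon_Nikodym_SigmaFinite.f_fin_num.
Qed.

(** The two densities agree [P]-almost everywhere, hence [Q]-almost everywhere by domination; [lne]
    and [ln] differ only where the density is at most 0, a [Q]-null set. This gives a real-valued
    integrand built on a density that is nonnegative and finite at every point. *)
Lemma KL_log_density P Q : Q `<< P ->
  KL Q P = \int[Q]_x (ln (fine (Radon_Nikodym_SigmaFinite.f Q P x)))%:E.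
Proof.
move=> QP; rewrite /KL; case: pselect => [/= _|/(_ QP)[]].
have mr : measurable_fun [set: T] (Radon_Nikodym_SigmaFinite.f Q P)
  by exact/measurable_int/Radon_Nikodym_SigmaFinite.f_integrable.
set r := Radon_Nikodym_SigmaFinite.f Q P in mr *.
set r' := Radon_Nikodym _ _.
have mr' : measurable_fun [set: T] r' by exact/measurable_int/Radon_Nikodym_integrable.
have fr' x : r' x \is a fin_num by exact: Radon_Nikodym_fin_num.
have mfr' : measurable_fun [set: T] (fun x => fine (r' x)) by exact: measurableT_comp.
have -> : (fun x => lne (r' x)) =
    (fun x => if (fine (r' x) <= 0)%R then -oo else (ln (fine (r' x)))%:E).
  by apply/funext => x; rewrite -{1}(fineK (fr' x)).
apply: ae_eq_integral => //.
- apply: measurable_fun_ifT => //.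
  + exact: measurable_fun_ler.
  + by apply/measurable_EFinP; apply: measurableT_comp.
- by apply/measurable_EFinP; do 2![apply: measurableT_comp => //].
have rr' : ae_eq Q setT r r'.
  apply: (null_dominates_ae_eq measurableT QP).
  exact: ae_eq_Radon_Nikodym_SigmaFinite.
move: rr' (density_gt0_ae QP); apply: filterS2 => x /= rr0 r0.
by rewrite -rr0// leNgt r0.
Qed.

(* The Donsker-Varadhan bound, in an exponentiated form which needs neither the
   logarithm nor the finiteness of the integrals. With [r = dQ/dP], integrate [ln r + g + exp (B - g) / r >= 1 + B]. *)
Lemma variational_lower_bound P Q g (B : R) : (0 <= B)%R ->
  measurable_fun [set: T] g -> (forall x, 0 <= g x)%R ->
  \int[P]_x (expR (B - g x))%:E <= 1 ->
  B%:E <= \int[Q]_x (g x)%:E + KL Q P.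
Proof.
move=> B0 mg g0 Ig.
have G0 : 0 <= \int[Q]_x (g x)%:E by apply: integral_ge0 => x _; rewrite lee_fin.
have [QP|nQP] := pselect (Q `<< P); last first.
  rewrite /KL; case: pselect => [/= /nQP[]|/= _].
  by rewrite addey ?leey// gt_eqF// (lt_le_trans _ G0)// ltNy0.
rewrite KL_log_density//.
have mr : measurable_fun [set: T] (Radon_Nikodym_SigmaFinite.f Q P)
  by exact/measurable_int/Radon_Nikodym_SigmaFinite.f_integrable.
have := @integral_tilted_le P Q.
move: mr; set r := Radon_Nikodym_SigmaFinite.f Q P => mr tilted.
pose h x := ln (fine (r x)).
have mh : measurable_fun [set: T] h by do 2![apply: measurableT_comp => //].
have mEh : measurable_fun [set: T] (fun x => (h x)%:E) by exact/measurable_EFinP.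
have mhp := measurable_funepos mEh.
have mhn := measurable_funeneg mEh.
have mexp w : measurable_fun [set: T] w ->
    measurable_fun [set: T] (fun x => expR (w x)) by move=> ?; exact: measurableT_comp.
have mhN : measurable_fun [set: T] (fun x => (- h x)%R) by exact: measurable_funN.
(* The negative part of [ln r] is at most [1 / r], whose [Q]-integral is at most 1. So [KL] is never
   of the form oo - oo. *)
have Hn1 : \int[Q]_x (fun x => (h x)%:E)^\- x <= 1.
  apply: (@le_trans _ _ (\int[P]_x 1%:E)); last first.
    by rewrite integral_cst// mul1e probability_le1.
  apply: le_trans (tilted (fun=> 1%R) QP _ _); [|exact: measurable_cst|by []].
  apply: ge0_le_integral => //.
    apply/measurable_EFinP/measurable_funM => //; exact: mexp.
  move=> x _; rewrite funenegE -EFin_max lee_fin mul1r -/(h x) ge_max expR_ge0.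
  by rewrite andbT (le_trans _ (expR_ge1Dx _))// lerDr.
have mu : measurable_fun [set: T] (fun x => (expR (B - g x) * expR (- h x))%:E).
  by apply/measurable_EFinP/measurable_funM; apply: mexp => //; exact: measurable_funB.
have U1 : \int[Q]_x (expR (B - g x) * expR (- h x))%:E <= 1.
  apply: (le_trans _ Ig); apply: (tilted (fun x => expR (B - g x))) => [//||x];
    last exact: expR_ge0.
  by apply: mexp; exact: measurable_funB.
(* This is [1 + t <= expR t] at [t = B - g - h], with the terms distributed so that both sides are
   nonnegative (hence [0 <= B]): integrals then add up without integrability conditions. *)
have le : \int[Q]_x ((fun x => (h x)%:E)^\- x + (1 + B)%:E) <=
    \int[Q]_x ((fun x => (h x)%:E)^\+ x + (g x)%:E +
      (expR (B - g x) * expR (- h x))%:E).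
  apply: ge0_le_integral => //.
  - by move=> x _; rewrite adde_ge0// lee_fin addr_ge0.
  - exact: emeasurable_funD.
  - apply: emeasurable_funD => //; apply: emeasurable_funD => //.
    exact/measurable_EFinP.
  move=> x _; rewrite funenegE funeposE -EFin_max -EFin_max -!EFinD lee_fin.
  rewrite -expRD.
  have := expR_ge1Dx (B - g x - h x).
  have [h0|h0] := lerP 0 (h x).
    by rewrite max_r; lra.
  by rewrite max_l; lra.
rewrite ge0_integralD// in le; last by move=> x _; rewrite lee_fin addr_ge0.
rewrite integral_cst//= probability_setT mule1 in le.
rewrite [leRHS]ge0_integralD// in le; last 2 first.
- by move=> x _; rewrite adde_ge0// lee_fin.
- by apply: emeasurable_funD => //; exact/measurable_EFinP.
rewrite [X in _ <= X + _]ge0_integralD// in le; last 2 first.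
- by move=> x _; rewrite lee_fin.
- exact/measurable_EFinP.
have Hp0 : 0 <= \int[Q]_x (fun x => (h x)%:E)^\+ x by exact: integral_ge0.
have Hn0 : 0 <= \int[Q]_x (fun x => (h x)%:E)^\- x by exact: integral_ge0.
have -> : \int[Q]_x (ln (fine (r x)))%:E =
    \int[Q]_x (fun x => (h x)%:E)^\+ x - \int[Q]_x (fun x => (h x)%:E)^\- x.
  by rewrite integralE.
(* The integrals of the negative part and of the exponential are finite, being at most 1. If one of
   the other two is infinite, the right-hand side is +oo. *)
move: Hp0 Hn0 Hn1 U1 G0 le.
move: (\int[Q]_x (_ ^\+ x)) (\int[Q]_x (_ ^\- x))
  (\int[Q]_x (_ * _)%:E) (\int[Q]_x (g x)%:E) => [p| |] [n| |] [u| |] [q| |] //.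
  rewrite -?EFinD !lee_fin.
  by lra.
all: by move=> *; rewrite ?leey.
Qed.

Lemma KL_ge0 P Q : 0 <= KL Q P.
Proof.
have := @variational_lower_bound P Q (fun=> 0%R) 0%R (lexx _).
rewrite integral0 add0e; apply => //.
under eq_integral do rewrite subrr expR0.
by rewrite integral_cst// mul1e probability_le1.
Qed.

End Gibbs.

(** * From exponential moments to means and to probabilities *)

Section ExponentialBounds.
Context {R : realType}.
Local Open Scope ereal_scope.

Lemma measurable_expeR : measurable_fun [set: \bar R] (@expeR R).
Proof.
move=> mD; apply: (measurability _ (ErealGenCInfty.measurableE R)) => //.
move=> _ [_ [y ->] <-]; apply: measurableI => //.
have [y0|y0] := leP y 0%R.
  rewrite (_ : _ @^-1` _ = setT)//; apply/seteqP; split => // x _ /=.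
  by rewrite in_itv/= andbT (le_trans _ (expeR_ge0 _))// lee_fin.
rewrite (_ : _ @^-1` _ = `[(ln y)%:E, +oo[%classic); first exact: emeasurable_itv.
apply/seteqP; split => x /=; rewrite !in_itv/= !andbT;
  by rewrite -(lee_expeR _ x)/= lnK ?posrE.
Qed.

Lemma le_expeR_lne (x y : \bar R) : 0 <= x -> lne x <= y -> x <= expeR y.
Proof. by move=> x0 xy; rewrite -[x](eqP (etrans (lneK_eq x) x0)) lee_expeR. Qed.

(** Jensen's inequality in a form without logarithms: integrate [1 + t <= expR t] at
    [t = c * g - a], rearranged so that both sides are nonnegative. *)
Lemma integral_le_of_expR_le1 d (T : measurableType d) (Q : probability T R)
    (g : T -> R) (a c : R) : (0 <= a)%R -> (0 < c)%R ->
  measurable_fun [set: T] g -> (forall x, 0 <= g x)%R ->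
  \int[Q]_x (expR (c * g x - a))%:E <= 1 ->
  \int[Q]_x (g x)%:E <= (a / c)%:E.
Proof.
move=> a0 c0 mg g0 I1.
have mcg : measurable_fun [set: T] (fun x => c * g x)%R by exact: measurable_funM.
have le : \int[Q]_x (c%:E * (g x)%:E + 1%:E) <=
    \int[Q]_x ((expR (c * g x - a))%:E + a%:E).
  apply: ge0_le_integral => //.
  - by move=> x _; rewrite -EFinM -EFinD lee_fin addr_ge0// mulr_ge0// ltW.
  - by apply: emeasurable_funD => //; exact/measurable_EFinP.
  - apply: emeasurable_funD => //; apply/measurable_EFinP/measurableT_comp => //.
    exact: measurable_funB.
  move=> x _; rewrite -EFinM -!EFinD lee_fin.
  by have := expR_ge1Dx (c * g x - a); lra.
rewrite ge0_integralD// in le; last 2 first.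
- by move=> x _; rewrite -EFinM lee_fin mulr_ge0// ltW.
- exact/measurable_EFinP.
rewrite integral_cst//= probability_setT mul1e in le.
rewrite ge0_integralD// in le; last first.
  by apply/measurable_EFinP/measurableT_comp => //; exact: measurable_funB.
rewrite integral_cst//= probability_setT mule1 in le.
rewrite ge0_integralZl// in le; last 3 first.
- exact/measurable_EFinP.
- by move=> x _; rewrite lee_fin.
- by rewrite lee_fin ltW.
have G0 : 0 <= \int[Q]_x (g x)%:E by apply: integral_ge0 => x _; rewrite lee_fin.
have I0 : 0 <= \int[Q]_x (expR (c * g x - a))%:E.
  by apply: integral_ge0 => x _; rewrite lee_fin expR_ge0.
move: I0 I1 G0 le; move: (\int[Q]_x (expR _)%:E) (\int[Q]_x (g x)%:E) => [i| |] [q| |] //.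
  rewrite -EFinM -!EFinD !lee_fin ler_pdivlMr// => *; lra.
by rewrite mulry gtr0_sg// mul1e.
Qed.

(** Markov's inequality at level 1 for the [Q]-average of [F], followed by Tonelli to integrate over
    the sample first, where condition (i) applies. *)
Lemma markov_tonelli d1 d2 (T1 : measurableType d1) (T2 : measurableType d2)
    (Q : probability T1 R) (P : probability T2 R) (F : T1 -> T2 -> R) :
  measurable_fun [set: T1 * T2] (fun z => F z.1 z.2) ->
  (forall y x, 0 <= F y x)%R ->
  measurable [set x | 1 <= \int[Q]_y (F y x)%:E] /\
  P [set x | 1 <= \int[Q]_y (F y x)%:E] <= \int[Q]_y \int[P]_x (F y x)%:E.
Proof.
move=> mF F0.
have mEF : measurable_fun [set: T1 * T2] (fun z => (F z.1 z.2)%:E).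
  exact/measurable_EFinP.
have EF0 z : 0 <= (F z.1 z.2)%:E by rewrite lee_fin.
have mG := @measurable_fun_fubini_tonelli_G _ _ _ _ _ Q _ mEF EF0.
have G0 x : 0 <= \int[Q]_y (F y x)%:E by apply: integral_ge0 => y _; rewrite lee_fin.
split.
  rewrite -[X in measurable X]setTI; exact: (emeasurable_fun_c_infty measurableT mG).
have := @le_integral_abse _ _ _ P _ measurableT _ 1%R mG ltr01.
rewrite mul1e setTI.
rewrite (@fubini_tonelli _ _ _ _ _ Q P _ mEF EF0) /fubini_G/=.
under eq_fun do rewrite gee0_abs//.
by under [X in _ <= X -> _]eq_integral do rewrite gee0_abs//.
Qed.

End ExponentialBounds.

(** * Tail bounds for the variational objective of one model *)

Section Deviations.
Context {R : realType} (S : experiment R).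
Local Open Scope ereal_scope.

Lemma measurable_loss_param k x : (1 <= k <= nmodels S)%N ->
  measurable_fun [set: param S k] (fun theta => loss S (Ptheta S theta) x).
Proof.
by move=> kM; exact: measurableT_comp (loss_measurable kM) (pair2_measurable x).
Qed.

Lemma measurable_loss_diff k : (1 <= k <= nmodels S)%N ->
  measurable_fun [set: param S k * sample S] (fun z => loss_diff z.1 z.2).
Proof.
move=> kM; apply: measurable_funB; first exact: loss_measurable.
exact: measurableT_comp (@loss_measurable_true R S) measurable_snd.
Qed.

(** The integrand is signed and may fail to be integrable, so Tonelli is applied to its positive and
    negative parts separately. *)
Lemma measurable_excess_risk k : (1 <= k <= nmodels S)%N ->
  measurable_fun [set: param S k] (@excess_risk R S k).
Proof.
move=> kM; have mL : measurable_fun [set: param S k * sample S]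
    (fun z => (loss_diff z.1 z.2)%:E).
  by apply/measurable_EFinP; exact: measurable_loss_diff.
have -> : @excess_risk R S k = (fun theta =>
    \int[Pstar S]_x ((fun z => (loss_diff z.1 z.2)%:E)^\+ (theta, x)) -
    \int[Pstar S]_x ((fun z => (loss_diff z.1 z.2)%:E)^\- (theta, x))).
  apply/funext => theta; rewrite /excess_risk unlock integralE.
  by congr (_ - _); apply: eq_integral => x _; rewrite ?funeposE ?funenegE.
apply: emeasurable_funB.
- exact: (measurable_fun_fubini_tonelli_F _ (measurable_funepos mL)).
- exact: (measurable_fun_fubini_tonelli_F _ (measurable_funeneg mL)).
Qed.

(** Common source of both tails: [a = - lambda] with [phi l = expeR (- (xi1 * l))] under the prior,
    and [a = lambda * xi2] with [phi l = expeR (xi3 * l)] under the distribution of (ii). The shift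
    [s] sets the trade-off between the threshold and the probability. *)
Lemma exponential_deviation k (Q : probability (param S k) R) (a s m : R)
    (phi : \bar R -> \bar R) : (1 <= k <= nmodels S)%N ->
  measurable_fun [set: \bar R] phi ->
  (forall theta : param S k,
    'E_(Pstar S)[fun x => expR (a * loss_diff theta x)]
      <= phi (excess_risk theta)) ->
  \int[Q]_theta phi (excess_risk theta) <= (expR m)%:E ->
  measurable [set x | 1 <= \int[Q]_theta (expR (a * loss_diff theta x - s))%:E] /\
  Pstar S [set x | 1 <= \int[Q]_theta (expR (a * loss_diff theta x - s))%:E]
    <= (expR (m - s))%:E.
Proof.
move=> kM mphi Ephi Iphi.
have mal : measurable_fun [set: param S k * sample S]
    (fun z => a * loss_diff z.1 z.2)%R.
  by apply: measurable_funM => //; exact: measurable_loss_diff.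
have mF : measurable_fun [set: param S k * sample S]
    (fun z => expR (a * loss_diff z.1 z.2 - s)).
  by apply: measurableT_comp => //; exact: measurable_funB.
have [|mB PB] := @markov_tonelli R _ _ _ _ Q (Pstar S)
  (fun theta x => expR (a * loss_diff theta x - s)) mF.
  by move=> *; exact: expR_ge0.
split => //; apply: (le_trans PB).
have mE (theta : param S k) : measurable_fun [set: sample S]
    (fun x => (expR (a * loss_diff theta x))%:E).
  have mt := measurableT_comp mal (pair1_measurable theta).
  exact/measurable_EFinP/(measurableT_comp (@measurable_expR R) mt).
have Efac (theta : param S k) : \int[Pstar S]_x (expR (a * loss_diff theta x - s))%:E =
    (expR (- s))%:E * \int[Pstar S]_x (expR (a * loss_diff theta x))%:E.
  rewrite -ge0_integralZl ?lee_fin ?expR_ge0//.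
  - by apply: eq_integral => x _; rewrite -EFinM -expRD addrC.
have mphiL : measurable_fun [set: param S k] (fun theta => phi (excess_risk theta)).
  by apply: measurableT_comp => //; exact: measurable_excess_risk.
have phi0 (theta : param S k) : 0 <= phi (excess_risk theta).
  apply: le_trans (Ephi theta); rewrite unlock.
  by apply: integral_ge0 => x _; rewrite lee_fin expR_ge0.
apply: (@le_trans _ _
    (\int[Q]_theta ((expR (- s))%:E * phi (excess_risk theta)))).
  apply: ge0_le_integral => //.
  - by move=> theta _; apply: integral_ge0 => x _; rewrite lee_fin expR_ge0.
  - apply: (measurable_fun_fubini_tonelli_F (fun z => (expR (a * loss_diff z.1 z.2 - s))%:E)).
      exact/measurable_EFinP.
    by move=> z; rewrite lee_fin expR_ge0.
  - exact: measurable_funeM.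
  move=> theta _; rewrite Efac lee_pmul2l ?lte_fin ?expR_gt0//.
  by have := Ephi theta; rewrite unlock.
rewrite ge0_integralZl// ?lee_fin ?expR_ge0// addrC expRD EFinM.
by rewrite lee_pmul2l ?lte_fin ?expR_gt0.
Qed.

Variables (lambda xi1 xi2 xi3 xi4 : R).
Hypotheses (lambda_gt0 : (0 < lambda)%R) (xi2_gt0 : (0 < xi2)%R)
  (xi4_gt0 : (0 < xi4)%R).
Hypothesis moments : loss_exponential_moments S lambda xi1 xi2 xi3.
Hypothesis family : good_variational_family S xi1 xi3 xi4.

(** By (ii), [xi4] times this quantity dominates a relative entropy, which is nonnegative. *)
Lemma model_excess_risk_ge0 k : (1 <= k <= nmodels S)%N ->
  0 <= model_excess_risk S xi1 k.
Proof.
move=> /family[Q [_ _ KLQ]].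
by rewrite -(@pmule_rge0 _ xi4%:E) ?lte_fin// (le_trans (KL_ge0 _ _) KLQ).
Qed.

(** The real [t] replaces the excess risk of the model, which may be infinite. The exceptional event
    does not depend on [Q], so the bound applies to a [Q] chosen from the data. *)
Lemma variational_objective_lower_tail k (t : R) : (1 <= k <= nmodels S)%N ->
  (0 <= t)%R -> t%:E <= model_excess_risk S xi1 k ->
  exists B : set (sample S), [/\ measurable B,
    Pstar S B <= (expR (- (t / 2)))%:E &
    forall x, ~ B x -> forall Q : probability (param S k) R,
      (lambda * loss S (Pstar S) x + t / 2)%:E
        <= variational_objective lambda x Q].
Proof.
move=> kM t0 tE.
have I : \int[prior S k]_theta expeR (- (xi1%:E * excess_risk theta))
    <= (expR (- t))%:E.
  rewrite -[(expR _)%:E]/(expeR (- t%:E)); apply: le_expeR_lne.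
    by apply: integral_ge0 => theta _; exact: expeR_ge0.
  by rewrite leeNr.
have mphi : measurable_fun [set: \bar R] (fun l => expeR (- (xi1%:E * l))).
  apply: measurableT_comp; first exact: measurable_expeR.
  apply: measurableT_comp => //; exact: measurable_funeM.
(* Of the exponent [t], one half pays for the probability of the event and the other half stays in
   the lower bound. *)
have [mB PB] := exponential_deviation (- (t / 2)) kM mphi
  (fun theta => (moments theta kM).1) I.
eexists; split; [exact: mB| |].
  by apply: (le_trans PB); rewrite lee_fin ler_expR; lra.
move=> x /negP; rewrite -ltNge => Zx Q; rewrite /variational_objective.
have mg := measurable_loss_param x kM.
rewrite -ge0_integralZl ?lee_fin ?(ltW lambda_gt0)//; last 2 first.
- exact/measurable_EFinP.
- by move=> theta _; rewrite lee_fin; exact: loss_ge0.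
under eq_integral do rewrite -EFinM.
apply: variational_lower_bound.
- by rewrite addr_ge0 ?mulr_ge0 ?loss_ge0 ?invr_ge0// ltW.
- exact: measurable_funM.
- by move=> theta; rewrite mulr_ge0 ?loss_ge0// ltW.
apply: le_trans (ltW Zx); rewrite le_eqVlt; apply/orP; left; apply/eqP.
by apply: eq_integral => theta _; congr (expR _)%:E; rewrite /loss_diff; lra.
Qed.

(** The competitor [Q] is chosen before the sample. Its mean loss contributes [(xi4 + 1) / xi2 * e]
    and its relative entropy [xi4 * e]. *)
Lemma variational_objective_upper_tail k (e : R) : (1 <= k <= nmodels S)%N ->
  (0 <= e)%R -> model_excess_risk S xi1 k = e%:E ->
  exists B : set (sample S), [/\ measurable B,
    Pstar S B <= (expR (- e))%:E &
    exists2 Q : probability (param S k) R, vfamily S k Q &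
    forall x, ~ B x -> variational_objective lambda x Q <=
      (lambda * loss S (Pstar S) x + ((xi4 + 1) / xi2 + xi4) * e)%:E].
Proof.
move=> kM e0 Ee; have [Q [VQ IQ KLQ]] := family kM; rewrite Ee in IQ KLQ.
have I : \int[Q]_theta expeR (xi3%:E * excess_risk theta)
    <= (expR (xi4 * e))%:E.
  rewrite -[(expR _)%:E]/(expeR (xi4%:E * e%:E)); apply: le_expeR_lne => //.
  by apply: integral_ge0 => theta _; exact: expeR_ge0.
have mphi : measurable_fun [set: \bar R] (fun l => expeR (xi3%:E * l)).
  apply: measurableT_comp; first exact: measurable_expeR.
  exact: measurable_funeM.
(* The log-moment is at most [xi4 * e]; the extra [e] in the shift becomes the probability
   [expR (- e)]. *)
have [mB PB] := exponential_deviation ((xi4 + 1) * e) kM mphi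
  (fun theta => (moments theta kM).2) I.
eexists; split; [exact: mB| |exists Q => //].
  by apply: (le_trans PB); rewrite lee_fin ler_expR; lra.
move=> x /negP; rewrite -ltNge => Yx; rewrite /variational_objective.
have mg := measurable_loss_param x kM.
rewrite -ge0_integralZl ?lee_fin ?(ltW lambda_gt0)//; last 2 first.
- exact/measurable_EFinP.
- by move=> theta _; rewrite lee_fin; exact: loss_ge0.
under eq_integral do rewrite -EFinM.
have ls0 := loss_ge0 (Pstar S) x.
rewrite mulrDl addrA [in leRHS]EFinD leeD//.
have -> : (lambda * loss S (Pstar S) x + (xi4 + 1) / xi2 * e =
    (xi2 * (lambda * loss S (Pstar S) x) + (xi4 + 1) * e) / xi2)%R.
  by field; rewrite gt_eqF.
apply: integral_le_of_expR_le1 => //.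
- by rewrite addr_ge0// mulr_ge0 ?addr_ge0 ?mulr_ge0// ltW.
- exact: measurable_funM.
- by move=> theta; rewrite mulr_ge0 ?loss_ge0// ltW.
apply: le_trans (ltW Yx); rewrite le_eqVlt; apply/orP; left; apply/eqP.
by apply: eq_integral => theta _; congr (expR _)%:E; rewrite /loss_diff; lra.
Qed.

End Deviations.

(** * The near-optimal and stopping indices, and the union bound *)

Lemma bigminn_leq (I : eqType) (r : seq I) (P : pred I) (F : I -> nat) (n : nat)
    (j : I) : j \in r -> P j -> (\big[minn/n]_(i <- r | P i) F i <= F j)%N.
Proof.
elim: r => // i r IH; rewrite inE big_cons => /predU1P[<- Pj|jr Pj].
  by rewrite Pj geq_minl.
by case: ifP => _; rewrite ?geq_min IH ?orbT.
Qed.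

Section StoppingIndex.
Context {R : realType} (S : experiment R).
Variables (lambda xi1 xi2 xi3 xi4 tau : R).
Variable Qhat : forall k, sample S -> probability (param S k) R.
Local Notation kd := (near_optimal_index S xi1 tau).
Local Notation E := (model_excess_risk S xi1).
Local Open Scope ereal_scope.

Lemma near_optimal_index_range : (1 <= kd <= nmodels S)%N.
Proof.
apply/andP; split; rewrite /near_optimal_index.
  rewrite big_nat_cond; elim/big_ind: _ => [|x y x1 y1|k /andP[/andP[]]//].
    exact: nmodels_gt0.
  by rewrite leq_min x1.
by elim/big_rec: _ => // k x _; rewrite geq_min => ->; rewrite orbT.
Qed.

Lemma near_optimal_index_drop k : (1 <= k < kd)%N ->
  (1 + tau)%:E * E k.+1 < E k.
Proof.
move=> /andP[k1 kkd]; rewrite ltNge; apply/negP => kle.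
have /andP[_ kdM] := near_optimal_index_range.
have kin : k \in index_iota 1 (nmodels S).
  by rewrite mem_index_iota k1 (leq_trans kkd kdM).
have := @bigminn_leq _ _ (fun k => E k <= (1 + tau)%:E * E k.+1) id
  (nmodels S) _ kin kle.
by rewrite leqNgt kkd.
Qed.

(** Stopping at [k] compares [k - 1] with [k], so descent from each of 1, ..., [kd - 1] excludes
    stopping at 2, ..., [kd]. Ties are harmless, as stopping requires a strict increase; the cap
    covers [kd = nmodels S]. *)
Lemma stopping_index_ge x :
  (forall k, (1 <= k < kd)%N -> mVFE lambda Qhat x k.+1 <= mVFE lambda Qhat x k) ->
  (minn kd.+1 (nmodels S) <= stopping_index lambda Qhat x)%N.
Proof.
move=> dec; rewrite /stopping_index big_nat_cond.
elim/big_ind: _ => [|m n mm mn|k /andP[/andP[k2 kM] kinc]].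
- by rewrite geq_minr.
- by rewrite leq_min mm.
rewrite geq_min; apply/orP; left; rewrite ltnNge; apply/negP => kkd.
move: kinc; rewrite ltNge => /negP; apply.
by case: k k2 kkd {kM} => [|[|k]]// _ kkd; apply: dec.
Qed.

Hypotheses (lambda_gt0 : (0 < lambda)%R) (xi2_gt0 : (0 < xi2)%R)
  (xi4_gt0 : (0 < xi4)%R).
Hypothesis moments : loss_exponential_moments S lambda xi1 xi2 xi3.
Hypothesis family : good_variational_family S xi1 xi3 xi4.
Hypothesis Qhat_min : forall k x, (1 <= k <= nmodels S)%N ->
  is_variational_posterior lambda x (Qhat k x).
Hypothesis tau_def : tau = (2 * ((xi4 + 1) / xi2 + xi4))%R.

Lemma tau_gt0 : (0 < tau)%R.
Proof.
rewrite tau_def mulr_gt0// addr_gt0// divr_gt0// addr_gt0//.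
Qed.

Lemma near_optimal_index_le k : (1 <= k <= kd)%N -> (1 <= k <= nmodels S)%N.
Proof.
have /andP[_ kdM] := near_optimal_index_range.
by move=> /andP[-> /leq_trans]; exact.
Qed.

Lemma near_optimal_index_ltS k : (1 <= k < kd)%N -> (1 <= k.+1 <= nmodels S)%N.
Proof. by move=> /andP[_ kkd]; apply: near_optimal_index_le. Qed.

(** The strict drop rules out an infinite value at [k + 1]; only [E 1] may be infinite. *)
Lemma near_optimal_index_fin k : (1 <= k < kd)%N ->
  exists2 e : R, (0 <= e)%R & E k.+1 = e%:E.
Proof.
move=> kkd; have := near_optimal_index_drop kkd.
have := model_excess_risk_ge0 xi4_gt0 family (near_optimal_index_ltS kkd).
case: (E k.+1) => [e e0 _|_|//]; first by exists e.
by rewrite mulry gtr0_sg ?addr_gt0 ?tau_gt0// mul1e ltNge leey.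
Qed.

Lemma model_excess_risk_decreasing k : (1 <= k <= kd)%N -> E kd <= E k.
Proof.
move=> /andP[k1 /subnKC]; move: (kd - k)%N => d.
elim: d k k1 => [|d IH] k k1 kd_eq; first by rewrite -kd_eq addn0.
have kkd : (1 <= k < kd)%N by rewrite k1 -kd_eq -addSnnS leq_addr.
apply: le_trans (IH k.+1 _ _) _ => //; first by rewrite addSnnS.
have := near_optimal_index_drop kkd; have [e e0 ->] := near_optimal_index_fin kkd.
move=> /ltW; apply: le_trans; rewrite -EFinM lee_fin ler_peMl// lerDl.
exact/ltW/tau_gt0.
Qed.

(** The upper tail at [k + 1] is compared with the lower tail at [k], taken at
    [t = (1 + tau) * E k.+1]. The probability is expressed through [E kd], the smallest value, so
    that it is the same for all [k]. *)
Lemma mVFE_step (k : nat) (e : R) : (1 <= k < kd)%N -> E kd = e%:E ->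
  exists B : set (sample S), [/\ measurable B,
    Pstar S B <= (2 * expR (- (e / 2)))%:E &
    forall x, ~ B x -> mVFE lambda Qhat x k.+1 <= mVFE lambda Qhat x k].
Proof.
move=> kkd Ekd; have /andP[k1 kltkd] := kkd.
have kM : (1 <= k <= nmodels S)%N.
  by apply: near_optimal_index_le; rewrite k1 ltnW.
have kM1 := near_optimal_index_ltS kkd.
have [f f0 Ef] := near_optimal_index_fin kkd.
have ef : (e <= f)%R.
  by rewrite -lee_fin -Ekd -Ef; exact: model_excess_risk_decreasing.
have tau0 := tau_gt0.
have t0 : (0 <= (1 + tau) * f)%R by rewrite mulr_ge0// addr_ge0// ltW.
have tE : ((1 + tau) * f)%:E <= E k.
  by rewrite EFinM -Ef; exact/ltW/near_optimal_index_drop.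
have [B1 [mB1 PB1 low]] := variational_objective_lower_tail lambda_gt0 moments kM t0 tE.
have [B2 [mB2 PB2 [Q VQ up]]] := variational_objective_upper_tail
  lambda_gt0 xi2_gt0 xi4_gt0 moments family kM1 f0 Ef.
have tauf : (0 <= tau * f)%R by rewrite mulr_ge0// ltW.
exists (B1 `|` B2); split; first exact: measurableU.
  apply: le_trans (measureU2 _ mB1 mB2) _.
  apply: le_trans (leeD PB1 PB2) _; rewrite -EFinD lee_fin.
  have h1 : (expR (- ((1 + tau) * f / 2)) <= expR (- (e / 2)))%R.
    by rewrite ler_expR; lra.
  have h2 : (expR (- f) <= expR (- (e / 2)))%R by rewrite ler_expR; lra.
  lra.
move=> x /not_orP[nB1 nB2]; rewrite /mVFE.
(* Minimality enters at [k + 1], against the competitor; at [k] the lower bound holds for every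
   distribution. *)
apply: le_trans ((Qhat_min x kM1).2 _ VQ) _.
apply: le_trans (up x nB2) _; apply: le_trans (low x nB1 _); rewrite lee_fin.
(* The upper excess is [tau / 2 * f] by the choice of [tau], and the lower one is
   [(1 + tau) * f / 2]. *)
by rewrite tau_def in tauf *; lra.
Qed.

Lemma stopping_index_deviation :
  measurable_fun [set: sample S] (stopping_index lambda Qhat) ->
  1 - eta S xi1 tau 4^-1 <=
  Pstar S [set x | (minn kd.+1 (nmodels S) <= stopping_index lambda Qhat x)%N].
Proof.
move=> mhat; set A := [set x | _].
have mA : measurable A.
  rewrite -[A]setTI; exact: (mhat measurableT [set n | (minn kd.+1 (nmodels S) <= n)%N]).
have eta0 : 0 <= eta S xi1 tau 4^-1.
  by rewrite /eta mule_ge0 ?lee_fin ?ler0n ?expeR_ge0.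
have /andP[kd_gt0 _] := near_optimal_index_range.
(* For [kd = 1] there is no descent to check and the event is the whole space; [E kd] may then be
   infinite. *)
have [kd1|kd2] := leqP kd 1.
  have -> : A = setT.
    apply/seteqP; split => // x _; apply: stopping_index_ge => k /andP[k1 kkd].
    by have := leq_ltn_trans k1 (leq_trans kkd kd1).
  by rewrite probability_setT -[leRHS]adde0 leeD2l// oppe_le0.
have [e e0 Ee] : exists2 e : R, (0 <= e)%R & E kd = e%:E.
  have := @near_optimal_index_fin kd.-1; rewrite prednK//; apply.
  by rewrite -ltnS prednK// kd2 leqnn.
have [etale1|etagt1] := leP (1 : \bar R) (eta S xi1 tau 4^-1).
  by rewrite (@le_trans _ _ 0)// sube_le0.
(* The [kd - 1] steps are numbered from 0: number [i] goes from model [i + 1] to model [i + 2]. *)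
have /choice[B HB] : forall i, exists B : set (sample S), (i < kd.-1)%N ->
    [/\ measurable B, Pstar S B <= (2 * expR (- (e / 2)))%:E &
    forall x, ~ B x -> mVFE lambda Qhat x i.+2 <= mVFE lambda Qhat x i.+1].
  move=> i; have [ikd|] := ltnP i kd.-1; last by exists set0.
  have [|B HB] := @mVFE_step i.+1 e _ Ee; last by exists B.
  by rewrite /= -ltnS prednK in ikd *.
have PAC : Pstar S (~` A) <= (\sum_(i < kd.-1) 2 * expR (- (e / 2)))%:E.
  apply: (@le_trans _ _ (Pstar S (\big[setU/set0]_(i < kd.-1) B i))).
    apply: le_measure; rewrite ?inE.
    - exact: measurableC.
    - by apply: bigsetU_measurable => i _; have [] := HB i (ltn_ord i).
    move=> x; apply: contra_notP => nB; apply: stopping_index_ge => -[//|k] kkd.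
    have ikd : (k < kd.-1)%N by rewrite -ltnS prednK.
    have [_ _] := HB k ikd; apply => Bx; apply: nB.
    by rewrite -bigcup_mkord; exists k.
  apply: le_trans (Boole_inequality _ _) _; first by move=> i /HB[].
  by rewrite -sumEFin; apply: lee_sum => i _; have [] := HB i (ltn_ord i).
rewrite -[A]setCK probability_setC; last exact: measurableC.
rewrite leeD2l// leeN2; apply: le_trans PAC _; move: etagt1.
rewrite /eta Ee /= -!EFinM lte_fin lee_fin sumr_const card_ord.
(* The union bound is at most [2 (kd - 1) y ^ 2] with [y <= 1 / 2] as soon as
   [eta = kd y < 1] and [kd >= 2]: this is where the exponent 1/4 comes from. *)
set y := expR (- (4^-1 * e)).
have -> : expR (- (e / 2)) = (y * y)%R by rewrite -expRD; congr expR; lra.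
have y0 : (0 < y)%R by exact: expR_gt0.
have -> : (kd%:R = kd.-1%:R + 1 :> R)%R by rewrite natr1 prednK.
have : (1 <= kd.-1%:R :> R)%R by rewrite ler1n -ltnS prednK.
rewrite -[(2 * _ *+ _)%R]mulr_natl; move: (kd.-1%:R : R)%R => n n1 yn.
have ny : (0 <= n * y)%R by rewrite mulr_ge0 ?(ltW y0)// (le_trans ler01).
have y2 : (0 <= 1 - 2 * y)%R by nra.
by have := mulr_ge0 ny y2; lra.
Qed.

End StoppingIndex.

Theorem theorem3p1 (R : realType) (S : nat -> experiment R) (lambda : R)
  (lambda_gt0 : 0 < lambda)
  (Qhat : forall n k, sample (S n) -> probability (param (S n) k) R)
  (Qhat_min : forall n k x, (1 <= k <= nmodels (S n))%N ->
     is_variational_posterior lambda x (Qhat n k x))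
  (mhat_measurable : forall n,
     measurable_fun [set: sample (S n)] (stopping_index lambda (Qhat n)))
  (xi1 xi2 xi3 : R) (xi1_gt0 : 0 < xi1) (xi2_gt0 : 0 < xi2) (xi3_gt0 : 0 < xi3)
  (cond_i : \forall n \near \oo,
     loss_exponential_moments (S n) lambda xi1 xi2 xi3)
  (cond_ii : exists2 xi4 : R, 0 < xi4 &
     \forall n \near \oo, good_variational_family (S n) xi1 xi3 xi4) :
  exists tau C2 : R, [/\ 0 < tau, 0 < C2 &
    \forall n \near \oo,
      (1 - eta (S n) xi1 tau C2 <=
       Pstar (S n)
         [set x | (minn (near_optimal_index (S n) xi1 tau).+1 (nmodels (S n))
                   <= stopping_index lambda (Qhat n) x)%N])%E].
Proof.
have [xi4 xi4_gt0 family] := cond_ii.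
(* [tau] is twice the constant of the upper tail, because the lower tail keeps only half of the
   excess risk. *)
exists (2 * ((xi4 + 1) / xi2 + xi4)), 4^-1; split => //.
- exact: tau_gt0 xi2_gt0 xi4_gt0 erefl.
near=> n; apply: (stopping_index_deviation lambda_gt0 xi2_gt0 xi4_gt0 _ _
  (Qhat_min n) erefl (mhat_measurable n)).
- by near: n; exact: cond_i.
- by near: n; exact: family.
Unshelve. all: by end_near.
Qed.
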